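(* Let $k\ge 1$ be an integer with binary expansion $k=2^{p_0}+2^{p_1}+\cdots+2^{p_s}$, where $0\le p_0<p_1<\cdots<p_s$ are integers. Then for every $k$-Leja section $E_k=(e_0,\dots,e_{k-1})$ of the closed unit disk $\mathcal U$ with $|e_0|=1$, the quadratic Lebesgue constant satisfies \[ \Lambda_{E_k,2}\le \sqrt{2^{-p_0}\,k}. \]
   Context: Let $\mathcal U=\{z\in\mathbb C: |z|\le 1\}$ be the closed unit disk. A $k$-Leja section of $\mathcal U$ is a finite sequence $E_k=(e_0,\dots,e_{k-1})$ of $k$ points of $\mathcal U$, with initial point satisfying $|e_0|=1$, such that for every $1\le m\le k-1$, \[ \prod_{j=0}^{m-1}|e_m-e_j|=\max_{z\in\mathcal U}\prod_{j=0}^{m-1}|z-e_j| . \] (At each step the maximizing point need not be unique; any choice is allowed. The points are automatically distinct.) The fundamental Lagrange interpolation polynomials associated with $E_k$ are \[ l_{j,E_k}(z)=\prod_{i=0,\,i\ne j}^{k-1}\frac{z-e_i}{e_j-e_i},\qquad 0\le j\le k-1, \] and the quadratic Lebesgue function and quadratic Lebesgue constant are \[ \lambda_{E_k,2}(z)=\Big(\sum_{j=0}^{k-1}|l_{j,E_k}(z)|^2\Big)^{1/2},\qquad \Lambda_{E_k,2}=\max_{z\in\mathcal U}\lambda_{E_k,2}(z). \] *)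

(* Defs.v *)
From mathcomp Require Import all_boot all_order all_algebra.
From mathcomp Require Import complex.
From mathcomp Require Import all_classical all_reals all_analysis.

Set Implicit Arguments.
Unset Strict Implicit.
Unset Printing Implicit Defensive.

Import Order.TTheory GRing.Theory Num.Theory.
Import ComplexField.Normc.
Import numFieldNormedType.Exports.
Local Open Scope classical_set_scope.
Local Open Scope ring_scope.
Local Open Scope complex_scope.

(* [ComplexField.Normc.normc : R[i] -> R] is the real-valued modulus;
   the generic norm of R[i] takes its values in R[i]. *)
Definition closed_unit_disk (R : realType) : set R[i] :=
  [set z | normc z <= 1].

(* The product inequality, with [e m] itself in the disk, says that [e m]
   realizes the maximum of the product over the disk. For k = 0 everything is
   vacuous. *)
Definition leja_section (R : realType) (k : nat) (e : 'I_k -> R[i]) : Prop :=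
  [/\ forall m : 'I_k, closed_unit_disk (e m),
      forall m : 'I_k, m = 0%N :> nat -> normc (e m) = 1
    & forall m : 'I_k, (1 <= m)%N -> forall z : R[i], closed_unit_disk z ->
        \prod_(j < k | (j < m)%N) normc (z - e j)
          <= \prod_(j < k | (j < m)%N) normc (e m - e j)].

Definition lagrange_fund (R : realType) (k : nat) (e : 'I_k -> R[i])
    (j : 'I_k) (z : R[i]) : R[i] :=
  \prod_(i < k | i != j) ((z - e i) / (e j - e i)).

Definition quad_lebesgue_fun (R : realType) (k : nat) (e : 'I_k -> R[i])
    (z : R[i]) : R :=
  Num.sqrt (\sum_(j < k) normc (lagrange_fund e j z) ^+ 2).

(* This supremum is a maximum: see [quad_lebesgue_const_attained]. *)
Definition quad_lebesgue_const (R : realType) (k : nat) (e : 'I_k -> R[i]) : R :=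
  sup [set quad_lebesgue_fun e z | z in @closed_unit_disk R].

Lemma normc_prod (R : realType) (I : finType) (P : pred I) (F : I -> R[i]) :
  normc (\prod_(i | P i) F i) = \prod_(i | P i) normc (F i).
Proof. by apply: (big_morph _ (@normcM R)); exact: normc1. Qed.

Lemma quad_lebesgue_fun_continuous (R : realType) (k : nat) (e : 'I_k -> R[i]) :
  continuous (fun p : R * R => quad_lebesgue_fun e (p.1 +i* p.2)).
Proof.
have cn (a : R[i]) : continuous (fun p : R * R => normc (p.1 +i* p.2 - a)).
  case: a => a b p /=; apply: continuous_comp; last exact: sqrt_continuous.
  have c1 : (fun q : R * R => q.1 - a) @ p --> p.1 - a.
    by apply: cvgB; [exact: cvg_fst|exact: cvg_cst].
  have c2 : (fun q : R * R => q.2 - b) @ p --> p.2 - b.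
    by apply: cvgB; [exact: cvg_snd|exact: cvg_cst].
  by apply: cvgD; [exact: (cvgM c1 c1)|exact: (cvgM c2 c2)].
have cf j : continuous
    (fun p : R * R => normc (lagrange_fund e j (p.1 +i* p.2)) ^+ 2).
  have -> : (fun p : R * R => normc (lagrange_fund e j (p.1 +i* p.2)) ^+ 2) =
      (fun p => (\prod_(i < k | i != j)
         (normc (p.1 +i* p.2 - e i) * (normc (e j - e i))^-1)) ^+ 2).
    apply/funext => p; rewrite /lagrange_fund normc_prod; congr (_ ^+ 2).
    by apply: eq_bigr => i _; rewrite normcM normcV.
  have cp : continuous (fun p : R * R => \prod_(i < k | i != j)
         (normc (p.1 +i* p.2 - e i) * (normc (e j - e i))^-1)).
    apply: continuous_big => [|i _ p]; first exact: mul_continuous.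
    by apply: cvgM; [exact: cn|exact: cvg_cst].
  by move=> p; exact: (cvgM (cp p) (cp p)).
move=> p; apply: continuous_comp; last exact: sqrt_continuous.
by apply: continuous_big; first exact: add_continuous.
Qed.

Lemma quad_lebesgue_const_attained (R : realType) (k : nat) (e : 'I_k -> R[i]) :
  exists z, [/\ closed_unit_disk z,
    quad_lebesgue_const e = quad_lebesgue_fun e z
  & forall w, closed_unit_disk w ->
      quad_lebesgue_fun e w <= quad_lebesgue_fun e z].
Proof.
pose D : set (R * R) := [set p | closed_unit_disk (p.1 +i* p.2)].
have D0 : D !=set0 by exists (0, 0); rewrite /D /= /closed_unit_disk /= expr0n /= addr0 sqrtr0.
have cD : compact D.
  apply: (@subclosed_compact (R * R)%type _ (`[-1, 1]%classic `*` `[-1, 1]%classic)).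
  - have -> : D = (fun p => normc (p.1 +i* p.2)) @^-1` [set x | x <= 1] by [].
    apply: preimage_closed; last exact: closed_le.
    move=> p _; apply: continuous_comp; last exact: sqrt_continuous.
    apply: cvgD.
      by apply: (@cvgM _ _ _ _ fst fst); exact: cvg_fst.
    by apply: (@cvgM _ _ _ _ snd snd); exact: cvg_snd.
  - by apply: compact_setX; exact: segment_compact.
  - move=> [x y]; rewrite /D /closed_unit_disk /= => n1.
    have n2 : x ^+ 2 + y ^+ 2 <= 1.
      by rewrite -[leLHS]sqr_sqrtr ?addr_ge0 ?sqr_ge0 // expr_le1 ?sqrtr_ge0.
    by split; rewrite in_itv /= -ler_norml -(@expr_le1 _ 2) // real_normK
      ?num_real //; apply: le_trans n2; rewrite ?lerDl ?lerDr sqr_ge0.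
have [c cD' cmax] := compact_EVT_max D0 cD
  (continuous_subspaceT (@quad_lebesgue_fun_continuous R k e)).
have cmx w : closed_unit_disk w ->
    quad_lebesgue_fun e w <= quad_lebesgue_fun e (c.1 +i* c.2).
  by case: w => x y xy; apply: (cmax (x, y)); rewrite inE.
exists (c.1 +i* c.2); rewrite inE in cD'; split => //.
apply/eqP; rewrite eq_le; apply/andP; split.
  apply: ge_sup => [|_ [w Dw <-]]; last exact: cmx.
  by exists (quad_lebesgue_fun e (c.1 +i* c.2)); exists (c.1 +i* c.2).
apply: ub_le_sup; last by exists (c.1 +i* c.2).
by exists (quad_lebesgue_fun e (c.1 +i* c.2)) => _ [w Dw <-]; exact: cmx.
Qed.

(* Main.v *)
(** The points of a Leja section come in antipodal pairs [e_(2j+1) = - e_(2j)]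
    on the unit circle, and the squares [e_(2j)^2] form a Leja section [F] of half
    the length.  Let [K_k(z, y)] be the sum of [l_j(z) * conj (l_j(y))], so that
    [K_k(z, z)] is the squared quadratic Lebesgue function.  Then
    [K_(2n)(z, y) = (1 + z conj y) / 2 * K^F_n(z^2, y^2)], which removes the even
    part [2^p_0] of [k] and reduces the theorem to [K_k(z, z) <= k].  For
    [k = 2n+1], adding one point to [K_(2n)] gives
    [2 K_(2n+1)(z, z) <= K^F_n + K^F_(n+1) + D + 2 (D - 1)], the kernels being
    taken at [(z^2, z^2)], where [D - 1] is the value of [K^F_n] on the diagonal
    at the next point of [F].  This [D] is 2 to the number of binary ones of [n]:
    either [n+1 = D] is a power of 2 and [K^F_(n+1) <= 1], or [3 D <= 2 (n+1)];
    the bound follows by strong induction in both cases. *)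

Require Import Defs.
From mathcomp Require Import all_boot all_order all_algebra.
From mathcomp Require Import complex ring zify.
From mathcomp Require Import all_classical all_reals all_analysis.
Import Order.TTheory GRing.Theory Num.Theory.
Local Open Scope ring_scope.

Lemma big_ord_double (R : Type) (idx : R) (op : Monoid.law idx) (n : nat)
    (F : nat -> R) :
  \big[op/idx]_(i < n.*2) F i =
  \big[op/idx]_(i < n) op (F i.*2) (F i.*2.+1).
Proof.
elim: n => [|n IHn]; first by rewrite !big_ord0.
by rewrite doubleS !big_ord_recr /= IHn Monoid.mulmA.
Qed.

(** * Leja sections, nodal polynomials and kernels *)

Section Leja.
Variable C : numClosedFieldType.
Implicit Types (e : nat -> C) (x y z : C).

(** Points are indexed by [nat] and only the first [n] are constrained, so that prefixes and
    sections of squares need no casts. *)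
Definition leja n e :=
  [/\ forall m, (m < n)%N -> `|e m| <= 1,
      (0 < n)%N -> `|e 0| = 1
    & forall m, (m < n)%N -> forall z, `|z| <= 1 ->
        \prod_(j < m) `|z - e j| <= \prod_(j < m) `|e m - e j|].

Definition nodal k e z := \prod_(i < k) (z - e i).

Definition sqseq e (i : nat) := e i.*2 ^+ 2.

Definition lagr k e (j : nat) z :=
  \prod_(i < k | i != j :> nat) ((z - e i) / (e j - e i)).

Definition kern k e z y := \sum_(j < k) lagr k e j z * (lagr k e j y)^*.

(** The fundamental polynomial of [e k] in the section of length [k.+1]. *)
Definition last_lagr k e z := nodal k e z / nodal k e (e k).

Lemma leja_leq m n e : (m <= n)%N -> leja n e -> leja m e.
Proof.
move=> mn [h1 h2 h3]; split=> [i im||i im]; first exact/h1/(leq_trans im).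
  by move=> m0; apply/h2/(leq_trans m0).
exact/h3/(leq_trans im).
Qed.

Lemma leja_nodal n e m z : leja n e -> (m < n)%N -> `|z| <= 1 ->
  `|nodal m e z| <= `|nodal m e (e m)|.
Proof. by move=> [_ _ h] mn z1; rewrite /nodal !normr_prod; exact: h. Qed.

Lemma nodal_double n e z :
  (forall i, (i < n)%N -> e i.*2.+1 = - e i.*2) ->
  nodal n.*2 e z = nodal n (sqseq e) (z ^+ 2).
Proof.
move=> he; rewrite /nodal (big_ord_double _ _ _ _ (fun i => z - e i)).
by apply: eq_bigr => i _; rewrite he // /sqseq /=; ring.
Qed.

Lemma nodal_neq0 k e z :
  (nodal k e z != 0) = [forall i : 'I_k, z != e i].
Proof.
apply/idP/forallP => [/prodf_neq0 h i|h].
  by rewrite -subr_eq0; exact: h.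
by apply/prodf_neq0 => i _; rewrite subr_eq0.
Qed.

(** * Antipodal pairs and squares in a Leja section *)

(** By the parallelogram identity, [|x + y| ^+ 2 <= 4 - 4 = 0]. *)
Lemma antipode x y : `|x| <= 1 -> `|y| <= 1 -> 2 <= `|x - y| -> x = - y.
Proof.
move=> x1 y1 xy; apply/eqP; rewrite -addr_eq0 -normr_eq0 -sqrf_eq0.
rewrite eq_le exprn_ge0 // andbT.
have -> : `|x + y| ^+ 2 = 2 * (`|x| ^+ 2 + `|y| ^+ 2) - `|x - y| ^+ 2.
  by rewrite !normCK rmorphD rmorphB /=; ring.
rewrite subr_le0 (@le_trans _ _ (2 ^+ 2)) //; last first.
  by rewrite lerXn2r ?nnegrE.
rewrite [leRHS]expr2 ler_pM2l ?ltr0n // -[leRHS]/(1 + 1).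
by apply: lerD; rewrite exprn_ile1.
Qed.

(* The maximum modulus principle is not needed: [e_(2j)^2] is a point of the
   shorter section of squares, so the induction gives [|e_(2j)| = 1]; and
   [e_(2j+1)] maximizes [|w_(2j)(z)| |z - e_(2j)|], where both factors are
   maximal at [- e_(2j)], the second one only there. *)
Lemma leja_struct n e : leja n e ->
  [/\ forall m, (m < n)%N -> `|e m| = 1,
      forall i, (i.*2.+1 < n)%N -> e i.*2.+1 = - e i.*2,
      leja (uphalf n) (sqseq e)
    & forall a b, (a < n)%N -> (b < n)%N -> e a = e b -> a = b].
Proof.
elim/ltn_ind: n e => -[|n] IH e he; first by split=> //; split.
have [h1 h0 hmax] := he.
have [nrm' anti' sq' inj'] := IH n (ltnSn n) e (leja_leq _ _ _ (leqnSn n) he).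
suff [nrm anti sq] : [/\ forall m, (m < n.+1)%N -> `|e m| = 1,
      forall i, (i.*2.+1 < n.+1)%N -> e i.*2.+1 = - e i.*2
    & leja (uphalf n.+1) (sqseq e)].
  (* Equal points have equal squares, so by induction on the squares they lie in the same pair,
     whose two points differ. Length 1 is treated apart, since [uphalf] does not shrink it. *)
  split=> // a b an bn eab.
  case: n IH {he h1 h0 hmax nrm' anti' sq' inj'} nrm anti sq an bn => [|n] IH nrm anti sq an bn.
    by lia.
  have [_ _ _ sqinj] := IH (uphalf n.+2) ltac:(lia) _ sq.
  have sqE i : (i < n.+2)%N -> e i ^+ 2 = sqseq e i./2.
    move=> i_lt; rewrite /sqseq; have := odd_double_half i.
    case: (odd i) => /= Ei; last by rewrite -{1}Ei add0n.
    by rewrite -{1}Ei add1n anti ?sqrrN //; lia.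
  have hab : a./2 = b./2 by apply: sqinj; rewrite -?sqE ?eab //; lia.
  have neq i : (i.*2.+1 < n.+2)%N -> e i.*2 <> e i.*2.+1.
    move=> i_lt; rewrite anti // => /eqP; rewrite -subr_eq0 opprK -mulr2n.
    by rewrite mulrn_eq0 /= -normr_eq0 nrm ?oner_eq0 //; lia.
  have := odd_double_half a; have := odd_double_half b; rewrite hab.
  case: (odd a); case: (odd b); rewrite ?add0n ?add1n => /= Eb Ea; try lia.
    by have /(_ ltac:(lia)) := neq b./2; rewrite Ea Eb; case.
  by have /(_ ltac:(lia)) := neq b./2; rewrite Eb Ea; case.
(* The last point [e n] either opens a pair or closes one. *)
have [[j nE]|[j nE]] : (exists j, n = j.*2) \/ (exists j, n = j.*2.+1).
- have := odd_double_half n; case: (odd n) => <-; [right|left];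
  by exists n./2; rewrite ?add1n ?add0n.
- subst n.
  have antij i : (i < j)%N -> e i.*2.+1 = - e i.*2 by move=> ij; apply: anti'; lia.
  have sq : leja j.+1 (sqseq e).
    split=> [m mj|_|m mj y y1].
    - by rewrite normrX exprn_ile1 // h1 //; lia.
    - by rewrite normrX h0 ?expr1n.
    have [->{m mj}|mj'] : m = j \/ (m < j)%N by lia.
      (* Every [y] in the disk is a square, so maximality of [e j.*2] passes to its square. *)
      rewrite -!normr_prod -!/(nodal _ _ _) -[y]sqrtCK -!nodal_double //.
      rewrite !normr_prod; apply: hmax => //.
      by rewrite -(@expr_le1 _ 2) // -normrX sqrtCK.
    case: sq' => _ _; apply=> //; lia.
  split.
  + move=> m; rewrite ltnS leq_eqVlt => /predU1P[->{m}|]; last exact: nrm'.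
    (* For [j = 0] the section of squares also has length 1, out of reach of the induction. *)
    case: (posnP j) => [->|j0]; first exact: h0.
    have [sqn _ _ _] := IH j.+1 ltac:(lia) _ sq.
    have := sqn j ltac:(lia); rewrite normrX => /eqP.
    by rewrite sqrp_eq1 // => /eqP.
  + by move=> i ij; apply: antij; lia.
  + by have -> : uphalf j.*2.+1 = j.+1 by lia.
- subst n.
  have antij i : (i < j)%N -> e i.*2.+1 = - e i.*2 by move=> ij; apply: anti'; lia.
  have anti : e j.*2.+1 = - e j.*2.
    have ej : `|e j.*2| = 1 by apply: nrm'; lia.
    apply: antipode; rewrite ?ej ?h1 //.
    have := leja_nodal _ _ _ (- e j.*2) he (ltnSn _).
    rewrite normrN ej lexx => /(_ isT).
    rewrite /nodal !big_ord_recr /= -!/(nodal _ _ _) !normrM.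
    have -> : nodal j.*2 e (- e j.*2) = nodal j.*2 e (e j.*2).
      by rewrite !nodal_double // sqrrN.
    rewrite -opprD normrN -mulr2n normrMn ej => le1.
    have M0 : 0 < `|nodal j.*2 e (e j.*2)|.
      rewrite normr_gt0 nodal_neq0; apply/forallP => i.
      by apply/eqP => /inj'; have := ltn_ord i; lia.
    rewrite -(ler_pM2l M0) (le_trans le1) // ler_wpM2r //.
    by apply: leja_nodal he _ _; rewrite ?h1 //; lia.
  split.
  + move=> m; rewrite ltnS leq_eqVlt => /predU1P[->{m}|]; last exact: nrm'.
    by rewrite anti normrN nrm'.
  + move=> i; rewrite ltnS leq_eqVlt => /predU1P[|]; last exact: anti'.
    by move=> /succn_inj/double_inj ->.
  + by have <- : uphalf j.*2.+1 = uphalf j.*2.+2 by lia.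
Qed.

(** * Adding one point to a kernel *)

(* Interpolating [l_j], of degree [k-1], at [e_0, ..., e_k] reproduces it. *)
Lemma lagr_recr k e j z :
  (j < k)%N -> (forall i, (i < k)%N -> e k != e i) ->
  lagr k.+1 e j z = lagr k e j z - last_lagr k e z * lagr k e j (e k).
Proof.
move=> jk ek.
have -> : lagr k.+1 e j z = lagr k e j z * ((z - e k) / (e j - e k)).
  rewrite /lagr big_mkcond big_ord_recr -big_mkcond /=.
  by rewrite ifT // neq_ltn jk orbT.
have nodalE y : nodal k e y = (y - e j) * \prod_(i < k | i != j :> nat) (y - e i).
  by rewrite /nodal (bigD1 (Ordinal jk)).
rewrite /last_lagr !nodalE /lagr !prodf_div.
set q := (\prod_(i < k | _) (e j - e i))^-1.
set P := \prod_(i < k | _) (z - e i).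
set Q := \prod_(i < k | _) (e k - e i).
have Q0 : Q != 0 by apply/prodf_neq0 => i _; rewrite subr_eq0 ek.
have kj : e k - e j != 0 by rewrite subr_eq0 ek.
have jk' : e j - e k != 0 by rewrite subr_eq0 eq_sym ek.
by field; rewrite Q0 kj jk'.
Qed.

Lemma lagr_last k e z : lagr k.+1 e k z = last_lagr k e z.
Proof.
rewrite /lagr big_mkcond big_ord_recr /= eqxx mulr1 /last_lagr /nodal -prodf_div.
by apply: eq_bigr => i _; rewrite ifT // neq_ltn ltn_ord.
Qed.

(** Expand the first [k] terms with [lagr_recr]; the new last term accounts for the [+ 1]. *)
Lemma kern_recr k e z y : (forall i, (i < k)%N -> e k != e i) ->
  kern k.+1 e z y = kern k e z y - last_lagr k e z * (kern k e y (e k))^*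
    - (last_lagr k e y)^* * kern k e z (e k)
    + last_lagr k e z * (last_lagr k e y)^* * (kern k e (e k) (e k) + 1).
Proof.
move=> ek; rewrite {1}/kern big_ord_recr /= !lagr_last mulrDr mulr1 addrA.
congr (_ + _); rewrite /kern rmorph_sum !mulr_sumr -!sumrB -big_split /=.
apply: eq_bigr => i _; rewrite !lagr_recr //.
by rewrite rmorphB !rmorphM /= conjCK; ring.
Qed.

(** * Halving a section by squaring its points *)

(** The antipode of [e b] contributes [(z + e b) / (2 * e b)], the leading factor because
    [conj (e b)] inverts [e b]; the other pairs merge into differences of squares. *)
Lemma lagr_double n e b z :
  (b < n.*2)%N -> (forall i, (i < n)%N -> e i.*2.+1 = - e i.*2) ->
  `|e b| = 1 ->
  lagr n.*2 e b z = (1 + z * (e b)^*) / 2 * lagr n (sqseq e) b./2 (z ^+ 2).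
Proof.
move=> bn anti nb; have jn : (b./2 < n)%N by lia.
have b0 : e b != 0 by rewrite -normr_eq0 nb oner_eq0.
have cb : (e b)^* = (e b)^-1 by rewrite invC_norm nb expr1n invr1 mul1r.
have bE : (b = b./2.*2) + (b = b./2.*2.+1) by case: (boolP (odd b)) => ?; [right|left]; lia.
have sqb : sqseq e b./2 = e b ^+ 2.
  by rewrite /sqseq; case: bE => bE; rewrite [in RHS]bE // anti // sqrrN.
rewrite {1}/lagr big_mkcond /=.
rewrite (big_ord_double _ _ _ _ (fun i => if i != b then (z - e i) / (e b - e i) else 1)).
rewrite (bigD1 (Ordinal jn)) //=; congr (_ * _).
  case: bE => bE.
    rewrite -bE eqxx mul1r ifT; last by apply/eqP; lia.
    by rewrite [b in b.+1]bE anti // -bE cb; field; rewrite b0 opprK -mulr2n mulrn_eq0.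
  rewrite -bE eqxx mulr1 ifT; last by apply/eqP; lia.
  have -> : e b./2.*2 = - e b by rewrite [in RHS]bE anti // opprK.
  by rewrite cb; field; rewrite b0 opprK -mulr2n mulrn_eq0.
rewrite /lagr sqb; apply: eq_bigr => i /eqP ij.
have ij' : i <> b./2 :> nat by move=> E; apply: ij; apply: val_inj.
rewrite !ifT; try by apply/eqP; case: bE; lia.
rewrite anti // /sqseq !subr_sqr invfM !opprK; ring.
Qed.

(** For a pair [a], [- a], use [(1 + z conj a)(1 + a conj y) + (1 - z conj a)(1 - a conj y) = 2 (1 +
    z conj y)]. *)
Lemma kern_double n e z y :
  (forall i, (i < n)%N -> e i.*2.+1 = - e i.*2) ->
  (forall m, (m < n.*2)%N -> `|e m| = 1) ->
  kern n.*2 e z y = (1 + z * y^*) / 2 * kern n (sqseq e) (z ^+ 2) (y ^+ 2).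
Proof.
move=> anti nrm; rewrite {1}/kern.
rewrite (big_ord_double _ _ _ _ (fun i => lagr n.*2 e i z * (lagr n.*2 e i y)^*)).
rewrite /kern mulr_sumr; apply: eq_bigr => i _ /=.
have ni : `|e i.*2| = 1 by rewrite nrm // ltn_double.
have in1 : (i.*2.+1 < n.*2)%N by have := ltn_ord i; lia.
have in0 : (i.*2 < n.*2)%N by rewrite ltn_double.
rewrite !lagr_double // ?nrm // anti // /= uphalf_double doubleK.
have : e i.*2 * (e i.*2)^* = 1 by rewrite -normCK ni expr1n.
set a := e _; set l := lagr n _ _ _; set l' := lagr n _ _ _ => aa.
rewrite !(rmorphM, rmorphD, rmorphN, fmorphV, rmorph1, rmorph_nat) /= conjCK.
have -> : (1 + z * y^* ) / 2 = (1 + z * y^* * (a * a^* )) / 2 :> C.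
  by rewrite aa mulr1.
by field.
Qed.

Lemma kern_ge0 k e z : 0 <= kern k e z z.
Proof. by apply: sumr_ge0 => j _; rewrite -normCK exprn_ge0. Qed.

Lemma leja_neq n e k i : leja n e -> (k < n)%N -> (i < k)%N -> e k != e i.
Proof.
move=> /leja_struct[_ _ _ inj] kn ik; apply/eqP => /inj.
by move=> /(_ kn (ltn_trans ik kn)) ki; rewrite ki ltnn in ik.
Qed.

Lemma leja_nodal_neq0 k e : leja k.+1 e -> nodal k e (e k) != 0.
Proof.
move=> he; rewrite nodal_neq0; apply/forallP => i.
exact: leja_neq he (ltnSn k) (ltn_ord i).
Qed.

Lemma last_lagr_le1 k e z : leja k.+1 e -> `|z| <= 1 -> `|last_lagr k e z| <= 1.
Proof.
move=> he z1; rewrite normf_div ler_pdivrMr ?normr_gt0 ?leja_nodal_neq0 //.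
by rewrite mul1r; exact: leja_nodal he _ z1.
Qed.

Lemma last_lagr_double n e z :
  (forall i, (i < n)%N -> e i.*2.+1 = - e i.*2) ->
  last_lagr n.*2 e z = last_lagr n (sqseq e) (z ^+ 2).
Proof. by move=> anti; rewrite /last_lagr !nodal_double. Qed.

(** Here [kern_recr] adds [a = e n.*2]; at the antipode [- a] the factor [1 + (- a) conj a]
    vanishes, while [last_lagr] keeps the value 1. *)
Lemma kern_double_succ n e z (K := kern n (sqseq e) (z ^+ 2) (sqseq e n))
    (T := last_lagr n (sqseq e) (z ^+ 2)) : leja n.*2.+2 e ->
  kern n.*2.+1 e z (e n.*2.+1) =
  T * (kern n (sqseq e) (sqseq e n) (sqseq e n) + 1) - z * (e n.*2)^* * K.
Proof.
move=> he; have [nrm anti sq _] := leja_struct _ _ he.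
have anti' i : (i < n)%N -> e i.*2.+1 = - e i.*2 by move=> ?; apply: anti; lia.
have nrm' m : (m < n.*2)%N -> `|e m| = 1 by move=> ?; apply: nrm; lia.
rewrite (_ : uphalf n.*2.+2 = n.+1) in sq; last by lia.
have aa : e n.*2 * (e n.*2)^* = 1 by rewrite -normCK nrm ?expr1n //; lia.
have -> : e n.*2.+1 = - e n.*2 by apply: anti; lia.
rewrite kern_recr; last by move=> i; apply: leja_neq he _; lia.
rewrite !kern_double // !last_lagr_double // !sqrrN -!/(sqseq e n) -/K -/T.
have -> : last_lagr n (sqseq e) (sqseq e n) = 1 by rewrite /last_lagr divff ?leja_nodal_neq0.
rewrite rmorphN aa mulNr aa subrr mul0r mul0r rmorph0 rmorph1.
set d := kern _ _ _ _; by field.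
Qed.

Lemma last_lagr_double_succ n e z : leja n.*2.+2 e ->
  last_lagr n.*2.+1 e z =
  last_lagr n (sqseq e) (z ^+ 2) * ((1 - z * (e n.*2)^*) / 2).
Proof.
move=> he; have [nrm anti _ _] := leja_struct _ _ he.
have anti' i : (i < n)%N -> e i.*2.+1 = - e i.*2 by move=> ?; apply: anti; lia.
have nn : `|e n.*2| = 1 by apply: nrm; lia.
have n0 : e n.*2 != 0 by rewrite -normr_eq0 nn oner_eq0.
have cn : (e n.*2)^* = (e n.*2)^-1 by rewrite invC_norm nn expr1n invr1 mul1r.
have -> : last_lagr n.*2.+1 e z =
    last_lagr n.*2 e z * ((z - e n.*2) / (e n.*2.+1 - e n.*2)).
  rewrite /last_lagr /nodal !big_ord_recr /= -!/(nodal _ _ _) anti; last by lia.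
  by rewrite !nodal_double // sqrrN invfM; ring.
rewrite last_lagr_double // anti; last by lia.
by congr (_ * _); rewrite cn; field; rewrite n0 -opprD oppr_eq0 -mulr2n mulrn_eq0.
Qed.

(** * The kernel at the next point *)

Lemma norm_half_le x y : `|x| <= 1 -> `|y| <= 1 -> `|(1 + x * y) / 2| <= 1.
Proof.
move=> x1 y1; rewrite normf_div ler_pdivrMr ?normr_gt0 ?pnatr_eq0 //.
rewrite mul1r normr_nat (le_trans (ler_normD _ _)) // normr1 -[leRHS]/(1 + 1).
by rewrite lerD2l normrM mulr_ile1.
Qed.

(* [D] is 2 to the number of ones in the binary expansion of [k]. *)
Lemma kern_next_bound k e : leja k.+1 e ->
  exists D : nat,
  [/\ kern k e (e k) (e k) + 1 = D%:R,
      (exists n, k.+1 = (2 ^ n)%N /\ D = k.+1) \/ (3 * D <= 2 * k.+1)%N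
    & forall z, `|z| <= 1 -> `|last_lagr k e z| * `|kern k e z (e k)| <= D%:R - 1].
Proof.
elim/ltn_ind: k e => k IH e he.
have [nrm anti sq _] := leja_struct _ _ he.
have [kE|kE] : k = k./2.*2 \/ k = k./2.*2.+1 by lia.
- move: (k./2) kE => n kE; subst k; rewrite (_ : uphalf n.*2.+1 = n.+1) in sq; last by lia.
  have anti' i : (i < n)%N -> e i.*2.+1 = - e i.*2 by move=> ?; apply: anti; lia.
  have nrm' m : (m < n.*2)%N -> `|e m| = 1 by move=> ?; apply: nrm; lia.
  have [->|n0] := posnP n.
    exists 1%N; split; first by rewrite /kern big_ord0 add0r.
      by left; exists 0%N.
    by move=> z _; rewrite /kern big_ord0 normr0 mulr0 subrr.
  have [D [DE Dle XD]] := IH n ltac:(lia) _ sq.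
  exists D; split.
  + rewrite kern_double // -!/(sqseq e n) -normCK nrm // expr1n.
    by rewrite -mulr2n divff ?mul1r ?pnatr_eq0.
  (* If [D = n.+1], the claim is [3 * n.+1 <= 2 * n.*2.+1], true because [n > 0]. *)
  + by right; case: Dle => [[? [_ ->]]|]; lia.
  move=> z z1; rewrite kern_double // last_lagr_double // [X in _ * X]normrM mulrCA.
  apply: (le_trans _ (XD (z ^+ 2) _)); last by rewrite normrX exprn_ile1.
  rewrite -[leRHS]mul1r ler_wpM2r ?mulr_ge0 //.
  by rewrite norm_half_le // norm_conjC nrm.
move: (k./2) kE => n kE; subst k.
rewrite (_ : uphalf n.*2.+2 = n.+1) in sq; last by lia.
have [D [DE Dle XD]] := IH n ltac:(lia) _ sq.
have aa : `|e n.*2| = 1 by apply: nrm; lia.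
exists (D.*2); split.
+ rewrite kern_double_succ // anti; last by lia.
  rewrite sqrrN -!/(sqseq e n) mulNr -normCK aa expr1n /last_lagr divff ?leja_nodal_neq0 //.
  by rewrite DE -mul2n natrM -DE; ring.
+ case: Dle => [[m [mE ->]]|]; [left|right; lia].
  by exists m.+1; rewrite expnS -mE; lia.
move=> z z1; rewrite kern_double_succ // DE last_lagr_double_succ //.
have z21 : `|z ^+ 2| <= 1 by rewrite normrX exprn_ile1.
have T1 : `|last_lagr n (sqseq e) (z ^+ 2)| <= 1 by apply: last_lagr_le1.
move: (XD _ z21) T1; rewrite -/(sqseq e n).
set T := last_lagr _ _ _; set K := kern _ _ _ _ => XDz T1.
rewrite normrM -mulrA.
have w1 : `|(1 - z * (e n.*2)^* ) / 2| <= 1.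
  by rewrite -mulrN norm_half_le // normrN norm_conjC aa.
(* The two parts, [|T| ^+ 2 * D <= D] and [|T| * |K| <= D - 1], add up to [D.*2 - 1]. *)
rewrite mulrA (le_trans (y := `|T| * (`|T| * D%:R + `|K|))) //.
  apply: ler_pM; rewrite ?mulr_ge0 //; first by rewrite ler_piMr.
  rewrite (le_trans (ler_normB _ _)) // !normrM norm_conjC aa mulr1 normr_nat.
  by rewrite lerD2l ler_piMl.
have -> : D.*2%:R - 1 = D%:R + (D%:R - 1) :> C by rewrite -addnn natrD addrA.
rewrite mulrDr.
apply: lerD => //; rewrite mulrA ler_piMl // mulr_ile1 //.
Qed.

(** * Bounding the kernel on the disk *)

(** Apply [kern_recr] to both [e] and [sqseq e]: [A1] absorbs the cross terms without [w], so only
    those carrying [w] remain. *)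
Lemma kern_two_step n e z (A := kern n (sqseq e) (z ^+ 2) (z ^+ 2))
    (A1 := kern n.+1 (sqseq e) (z ^+ 2) (z ^+ 2))
    (K := kern n (sqseq e) (z ^+ 2) (sqseq e n))
    (d := kern n (sqseq e) (sqseq e n) (sqseq e n))
    (T := last_lagr n (sqseq e) (z ^+ 2)) (w := z * (e n.*2)^* ) :
  leja n.*2.+1 e ->
  2 * kern n.*2.+1 e z z =
  A1 + z * z^* * A + T * T^* * (d + 1) - (T^* * (w * K) + (T^* * (w * K))^* ).
Proof.
move=> he; have [nrm anti sq _] := leja_struct _ _ he.
rewrite (_ : uphalf n.*2.+1 = n.+1) in sq; last by lia.
have anti' i : (i < n)%N -> e i.*2.+1 = - e i.*2 by move=> ?; apply: anti; lia.
have nrm' m : (m < n.*2)%N -> `|e m| = 1 by move=> ?; apply: nrm; lia.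
have aa : e n.*2 * (e n.*2)^* = 1 by rewrite -normCK nrm ?expr1n //; lia.
rewrite /A1 !kern_recr; first last.
- by move=> i; apply: leja_neq he _; lia.
- by move=> i; apply: leja_neq sq _; lia.
rewrite !kern_double // !last_lagr_double // -!/(sqseq e n) -/K -/T -/A -/d aa -/w.
clearbody A K d T; rewrite !(rmorphM, rmorphD, fmorphV, rmorph1, rmorph_nat) /= !conjCK.
by field.
Qed.

(** Each doubling brings a factor [(1 + |z|^2) / 2 <= 1], so the bound survives. *)
Lemma kern_pow2_le m (b : C) p e z :
  (forall e z, leja m e -> `|z| <= 1 -> kern m e z z <= b) ->
  leja (2 ^ p * m) e -> `|z| <= 1 -> kern (2 ^ p * m) e z z <= b.
Proof.
move=> hm; elim: p e z => [|p IH] e z he z1; first by rewrite mul1n in he *; exact: hm.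
rewrite expnS -mulnA mul2n in he *.
have [nrm anti sq _] := leja_struct _ _ he.
rewrite uphalf_double in sq.
have z21 : `|z ^+ 2| <= 1 by rewrite normrX exprn_ile1.
rewrite kern_double //; last by move=> i ?; apply: anti; lia.
apply: le_trans (IH _ _ sq z21).
rewrite ler_piMl ?kern_ge0 // ler_pdivrMr ?ltr0n // mul1r -[leRHS]/(1 + 1).
by rewrite lerD2l -normCK exprn_ile1.
Qed.

(** Doubling starts from the one-point section, whose kernel is constantly 1. *)
Lemma kern_le_pow2 p e z : leja (2 ^ p) e -> `|z| <= 1 -> kern (2 ^ p) e z z <= 1.
Proof.
rewrite -[(2 ^ p)%N]muln1; apply: kern_pow2_le => {}e {}z _ _.
rewrite kern_recr // /kern !big_ord0 /last_lagr /nodal !big_ord0 divr1 rmorph0 rmorph1.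
by rewrite !mulr0 !subr0 !add0r !mulr1.
Qed.

Lemma kern_le k e z : leja k e -> `|z| <= 1 -> kern k e z z <= k%:R.
Proof.
elim/ltn_ind: k e z => k IH e z he z1.
have z21 : `|z ^+ 2| <= 1 by rewrite normrX exprn_ile1.
have [->|k0] := posnP k; first by rewrite /kern big_ord0.
have [kE|kE] : k = k./2.*2 \/ k = k./2.*2.+1 by lia.
  move: (k./2) kE => n kE; subst k; rewrite -mul2n -[in leLHS](expn1 2) in he *.
  apply: le_trans (kern_pow2_le _ n%:R 1 e z _ he z1) _ => [e' z'|].
    by apply: IH; lia.
  by rewrite ler_nat; lia.
move: (k./2) kE => n kE; subst k.
have [nrm _ sq _] := leja_struct _ _ he.
rewrite (_ : uphalf n.*2.+1 = n.+1) in sq; last by lia.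
have [D [DE Dle XD]] := kern_next_bound _ _ sq.
have aa : `|e n.*2| = 1 by apply: nrm; lia.
rewrite -(@ler_pM2l _ 2) ?ltr0n // -natrM.
(* The kernel is replaced by its norm so that the triangle inequality applies to [kern_two_step]. *)
have /ger0_norm <- : 0 <= 2 * kern n.*2.+1 e z z by rewrite mulr_ge0 ?kern_ge0.
rewrite kern_two_step // DE.
have AB : kern n.+1 (sqseq e) (z ^+ 2) (z ^+ 2)
    + kern n (sqseq e) (z ^+ 2) (z ^+ 2) + D%:R + (D%:R - 1) *+ 2
    <= (2 * n.*2.+1)%:R.
  have A_le : kern n (sqseq e) (z ^+ 2) (z ^+ 2) <= n%:R.
    by apply: IH => //; [lia|exact: leja_leq sq].
  (* Take [a = 1] if [n.+1 = D] is a power of 2, and [a = n.+1] if [3 * D <= 2 * n.+1]. The right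
     side is [2 * n.*2.+1] plus the 2 subtracted in [(D - 1) *+ 2]. *)
  have [a [A1_le aD]] : exists a : nat,
      kern n.+1 (sqseq e) (z ^+ 2) (z ^+ 2) <= a%:R /\ (a + n + 3 * D <= 4 * n.+1)%N.
    case: Dle => [[p [nE DE']]|Dle].
      exists 1%N; split; last by lia.
      by move: sq; rewrite nE => sq; exact: kern_le_pow2.
    exists n.+1; split; last by lia.
    (* For [n = 0] the lengths [n.+1] and [n.*2.+1] agree, so the induction hypothesis does not
       apply. *)
    have [n0|n0] := posnP n; last by apply: IH => //; lia.
    by move: sq; rewrite n0 => sq; exact: (kern_le_pow2 0).
  rewrite mulrnBl addrA lerBlDr (le_trans (y := (a + n + 3 * D)%:R)) //; last first.
    by rewrite -natrD ler_nat; lia.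
  rewrite (_ : (a + n + 3 * D)%N = (a + n + D + D * 2)%N); last by lia.
  by rewrite !natrD natrM mulr_natr !lerD2r lerD.
apply: le_trans AB.
rewrite (le_trans (ler_normB _ _)) //; apply: lerD; last first.
  rewrite (le_trans (ler_normD _ _)) // norm_conjC -mulr2n lerMn2r /=.
  apply: le_trans (XD _ z21); rewrite 3!normrM !norm_conjC aa mulr1 ler_wpM2l //.
  by rewrite ler_piMl.
rewrite (le_trans (ler_normD _ _)) //; apply: lerD; last first.
  by rewrite 2!normrM norm_conjC normr_nat ler_piMl // mulr_ile1 ?last_lagr_le1 //.
rewrite (le_trans (ler_normD _ _)) // ger0_norm ?kern_ge0 // lerD2l.
rewrite !normrM norm_conjC (ger0_norm (kern_ge0 _ _ _)) ler_piMl ?kern_ge0 //.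
by rewrite mulr_ile1.
Qed.

End Leja.

(** * Transfer to [R[i]] and conclusion *)

Local Open Scope complex_scope.

Lemma norm_normc (R : realType) (z : R[i]) :
  `|z| = (ComplexField.Normc.normc z)%:C.
Proof. by case: z. Qed.

(** [inord] extends [e] to [nat]; indices past [k] get a default value that is never read. *)
Lemma leja_section_leja (R : realType) (k : nat) (e : 'I_k.+1 -> R[i]) :
  leja_section e -> leja _ k.+1 (fun i => e (inord i)).
Proof.
move=> [h1 h0 hmax]; split=> [m mk|_|m mk z z1].
- by rewrite norm_normc lecR; exact: h1.
- by rewrite norm_normc h0 // inordK.
have [->|m0] := posnP m; first by rewrite !big_ord0.
have prodE y : \prod_(j < m) `|y - e (inord j)| =
    (\prod_(j < k.+1 | (j < (inord m : 'I_k.+1))%N) ComplexField.Normc.normc (y - e j))%:C.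
  rewrite rmorph_prod (big_ord_widen_cond k.+1 predT (fun j => `|y - e (inord j)|)) /=.
    by apply: eq_big => i; rewrite ?inordK // ?inord_val ?norm_normc.
  by rewrite ltnW.
rewrite !prodE lecR; apply: hmax; first by rewrite inordK.
by rewrite /closed_unit_disk /= -lecR -norm_normc.
Qed.

Lemma quad_lebesgue_fun_kern (R : realType) (k : nat) (e : 'I_k.+1 -> R[i]) z :
  (quad_lebesgue_fun e z ^+ 2)%:C = kern _ k.+1 (fun i => e (inord i)) z z.
Proof.
rewrite /quad_lebesgue_fun sqr_sqrtr; last by apply: sumr_ge0 => j _; exact: sqr_ge0.
rewrite rmorph_sum; apply: eq_bigr => j _.
rewrite rmorphXn -normCK /= -norm_normc /lagr /lagrange_fund; congr (`|_| ^+ 2).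
by apply: eq_bigr => i _; rewrite !inord_val.
Qed.

Theorem proposition1 (R : realType) (k : nat) (hk : (1 <= k)%N)
    (s : nat) (p : 'I_s.+1 -> nat)
    (hp : forall i j : 'I_s.+1, (i < j)%N -> (p i < p j)%N)
    (hkp : k = (\sum_(i < s.+1) 2 ^ p i)%N)
    (e : 'I_k -> R[i]) (he : leja_section e) :
  quad_lebesgue_const e <= Num.sqrt (2%:R ^- p ord0 * k%:R).
Proof.
have p0le i : (p ord0 <= p i)%N.
  by have [->//|i0] := eqVneq i ord0; apply/ltnW/hp; rewrite /= lt0n.
(* Every exponent is at least [p ord0], so [2 ^ p ord0] divides [k]; the quotient [m] is the bound
   sought under the root. *)
have [m km] : exists m, k = (2 ^ p ord0 * m)%N.
  exists (\sum_(i < s.+1) 2 ^ (p i - p ord0))%N; rewrite hkp big_distrr /=.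
  by apply: eq_bigr => i _; rewrite -expnD subnKC.
clear hkp; case: k hk e he km => // k _ e he km.
have [z [z1 -> _]] := quad_lebesgue_const_attained e.
have -> : 2%:R ^- p ord0 * k.+1%:R = m%:R :> R.
  by rewrite km natrM natrX mulrA mulVf ?mul1r ?expf_neq0 ?pnatr_eq0.
rewrite -[leLHS]ger0_norm ?sqrtr_ge0 // -sqrtr_sqr ler_wsqrtr //.
rewrite -lecR quad_lebesgue_fun_kern rmorph_nat.
move: (leja_section_leja _ _ _ he); move: (fun i => e (inord i)) => f.
rewrite km => hf; apply: kern_pow2_le hf _ => [f' z'|]; first exact: kern_le.
by rewrite norm_normc -[1]/(1%:C) lecR.
Qed.
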